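(* Let $n\ge 1$ and let $\mathcal{A}_n$ be the set of $n\times n$ alternating sign matrices. Let $G_n$ be the $n\times n$ grid graph and let $\mathrm{ResLuc}(G_n)$ be the set of restricted Lucas-colorings of $G_n$ (both defined in the context). Then there is a bijection between $\mathcal{A}_n$ and $\mathrm{ResLuc}(G_n)$.
   Context: An alternating sign matrix (ASM) is a square matrix with entries in $\{-1,0,+1\}$ such that every row and every column sums to $1$ and, in each row and each column, the non-zero entries alternate in sign. The grid graph $G_n$: take $n$ horizontal line segments $H_1,\dots,H_n$ (from top to bottom) and $n$ vertical line segments $V_1,\dots,V_n$ (from left to right) in the plane such that each $H_i$ meets each $V_j$ transversally in exactly one point. The vertices of $G_n$ are the $n^2$ intersection points $H_i\cap V_j$ (the internal vertices, each of degree $4$) together with the $4n$ endpoints of the segments (each of degree $1$); the edges are the sub-segments between consecutive vertices along each $H_i$ and each $V_j$. A boundary edge is an edge incident to an endpoint. The boundary edges form four sides: the $n$ edges at the left ends of the $H_i$, the $n$ edges at the top ends of the $V_j$, the $n$ edges at the right ends of the $H_i$, and the $n$ edges at the bottom ends of the $V_j$, each side ordered along the boundary. At each of the four corners of the grid, two boundary edges are nearest to that corner, one from each of the two sides meeting there (e.g. at the top-left corner: the left edge of $H_1$ and the top edge of $V_1$). A restricted Lucas-coloring of $G_n$ is a coloring of the edges of $G_n$ by the two colors red and green such that: (1) at each internal vertex, the four incident edges are either all green, or all red, or exactly two of them are red and these two are consecutive in the cyclic order around the vertex (i.e. one lies on the horizontal line and one on the vertical line through the vertex) — these are the six allowed local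 colorings; (2) on each of the four sides, the $n$ boundary edges alternate in color along the side; (3) at each of the four corners, the two boundary edges nearest to that corner have the same color; (4) (normalization) the boundary edge at the left end of $H_1$ is green. *)

(* Defs.v *)
From HB Require Import structures.
From mathcomp Require Import all_boot all_order all_algebra.

Set Implicit Arguments.
Unset Strict Implicit.
Unset Printing Implicit Defensive.

Import GRing.Theory Num.Theory.
Local Open Scope ring_scope.

Definition sign_alternating (s : seq int) : bool :=
  sorted (fun x y => x * y < 0) [seq x <- s | x != 0].

Definition is_asm (n : nat) (A : 'M[int]_n) : bool :=
  [&& [forall i, forall j, A i j \in [:: -1; 0; 1]],
      [forall i, \sum_j A i j == 1],
      [forall j, \sum_i A i j == 1],
      [forall i, sign_alternating [seq A i j | j <- enum 'I_n]]
    & [forall j, sign_alternating [seq A i j | i <- enum 'I_n]]].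

Definition ASM (n : nat) : Type := {A : 'M[int]_n | is_asm A}.

(* Indices are 0-based: the ordinal i stands for H_(i+1) or V_(i+1).
   Endpoint Left i and Endpoint Right i are the ends of a horizontal line,
   Endpoint Top j and Endpoint Bottom j those of a vertical line. *)
Variant side := Left | Top | Right | Bottom.

Variant gvertex (n : nat) :=
  | Internal of 'I_n & 'I_n
  | Endpoint of side & 'I_n.
Arguments Internal {n}.
Arguments Endpoint {n}.

(* The n + 2 vertices on a line, numbered 0, ..., n + 1 from left to right
   (resp. from top to bottom). *)
Definition hvertex (n : nat) (i : 'I_n) (k : nat) : gvertex n :=
  if k is k'.+1 then
    if insub k' is Some j then Internal i j else Endpoint Right i
  else Endpoint Left i.

Definition vvertex (n : nat) (j : 'I_n) (k : nat) : gvertex n :=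
  if k is k'.+1 then
    if insub k' is Some i then Internal i j else Endpoint Bottom j
  else Endpoint Top j.

(* inl (i, k) is the k-th of the n + 1 edges of a horizontal line, counted from
   the left; inr (j, k) the k-th edge of a vertical line, counted from the
   top. *)
Definition gedge (n : nat) : finType :=
  ('I_n * 'I_n.+1 + 'I_n * 'I_n.+1)%type.

Definition hedge (n : nat) (i : 'I_n) (k : 'I_n.+1) : gedge n := inl (i, k).
Definition vedge (n : nat) (j : 'I_n) (k : 'I_n.+1) : gedge n := inr (j, k).

Definition gends (n : nat) (e : gedge n) : gvertex n * gvertex n :=
  match e with
  | inl (i, k) => (hvertex i k, hvertex i k.+1)
  | inr (j, k) => (vvertex j k, vvertex j k.+1)
  end.

Definition incident (n : nat) (e : gedge n) (v : gvertex n) : Prop :=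
  (gends e).1 = v \/ (gends e).2 = v.

(* The edges at an internal vertex in cyclic order: left, top, right, bottom. *)
Definition edges_around (n : nat) (i j : 'I_n) : seq (gedge n) :=
  [:: hedge i (inord j); vedge j (inord i);
      hedge i (inord j.+1); vedge j (inord i.+1)].

Definition boundary_edge (n : nat) (s : side) (k : 'I_n) : gedge n :=
  match s with
  | Left => hedge k ord0
  | Top => vedge k ord0
  | Right => hedge k ord_max
  | Bottom => vedge k ord_max
  end.

Lemma hvertex_internal n (i' : 'I_n) (k : nat) (i j : 'I_n) :
  hvertex i' k = Internal i j <-> i' = i /\ k = j.+1.
Proof.
split=> [|[-> ->]] /=; last by rewrite valK.
case: k => [|k] //=; case: insubP => // u _ <- [-> ->] //.
Qed.

Lemma vvertex_internal n (j' : 'I_n) (k : nat) (i j : 'I_n) :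
  vvertex j' k = Internal i j <-> j' = j /\ k = i.+1.
Proof.
split=> [|[-> ->]] /=; last by rewrite valK.
case: k => [|k] //=; case: insubP => // u _ <- [-> ->] //.
Qed.

Lemma incident_internal n (e : gedge n) (i j : 'I_n) :
  incident e (Internal i j) <-> e \in edges_around i j.
Proof.
have ltS (k : 'I_n) : (k < n.+1)%N by rewrite ltnS ltnW.
have ltSS (k : 'I_n) : (k.+1 < n.+1)%N by rewrite ltnS.
rewrite /edges_around !inE; case: e => [] [l k]; split.
- case=> /hvertex_internal [-> h]; apply/or4P; [apply: Or43 | apply: Or41];
    apply/eqP; congr (inl (_, _)); apply: val_inj; rewrite /= inordK //.
  by case: h.
- case/or4P=> /eqP // [-> ->]; [right | left];
    by apply/hvertex_internal; rewrite inordK.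
- case=> /vvertex_internal [-> h]; apply/or4P; [apply: Or44 | apply: Or42];
    apply/eqP; congr (inr (_, _)); apply: val_inj; rewrite /= inordK //.
  by case: h.
- case/or4P=> /eqP // [-> ->]; [right | left];
    by apply/vvertex_internal; rewrite inordK.
Qed.

Lemma incident_endpoint n (e : gedge n) (s : side) (k : 'I_n) :
  incident e (Endpoint s k) <-> e = boundary_edge s k.
Proof.
have max (m : 'I_n.+1) : ~~ (m < n)%N -> m = ord_max.
  by rewrite -leqNgt => h; apply/val_inj/eqP; rewrite /= eqn_leq h -ltnS ltn_ord.
rewrite /incident; split.
  case: e => [] [l m] /=; case=> h.
  - case: m h => [[|m] mn] /=; first by case=> <- <-; congr (inl (_, _)); apply: val_inj.
    by case: insubP => //; rewrite -ltnS mn.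
  - by move: h; case: insubP => // mn [<- <-]; rewrite (max _ mn).
  - case: m h => [[|m] mn] /=; first by case=> <- <-; congr (inr (_, _)); apply: val_inj.
    by case: insubP => //; rewrite -ltnS mn.
  - by move: h; case: insubP => // mn [<- <-]; rewrite (max _ mn).
move=> ->; case: s => /=; [by left | by left | right | right];
  by rewrite insubF // ltnn.
Qed.

Variant color := Red | Green.

Definition is_red (x : color) : bool := if x is Red then true else false.
Lemma is_redK : cancel is_red (fun b => if b then Red else Green).
Proof. by case. Qed.
HB.instance Definition _ := Finite.copy color (can_type is_redK).

(* Exactly two red edges, cyclically consecutive, means that the colors read
   Red, Red, Green, Green from a suitable starting edge. *)
Definition lucas_at (n : nat) (c : {ffun gedge n -> color})
    (i j : 'I_n) : bool :=
  let s := [seq c e | e <- edges_around i j] in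
  [|| all (pred1 Green) s, all (pred1 Red) s
    | [exists r : 'I_4, rot r s == [:: Red; Red; Green; Green]]].

Definition side_alternating (n : nat) (c : {ffun gedge n -> color})
    (s : side) : bool :=
  [forall k : 'I_n, forall l : 'I_n,
    (l == k.+1 :> nat) ==> (c (boundary_edge s k) != c (boundary_edge s l))].

(* a and z are the first and last indices. *)
Definition corners_agree (n : nat) (c : {ffun gedge n -> color}) : bool :=
  [forall a : 'I_n, forall z : 'I_n, (a == 0%N :> nat) && (z.+1 == n) ==>
    [&& c (boundary_edge Left a) == c (boundary_edge Top a),
        c (boundary_edge Top z) == c (boundary_edge Right a),
        c (boundary_edge Right z) == c (boundary_edge Bottom z)
      & c (boundary_edge Bottom a) == c (boundary_edge Left z)]].

Definition top_left_green (n : nat) (c : {ffun gedge n -> color}) : bool :=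
  [forall a : 'I_n, (a == 0%N :> nat) ==> (c (boundary_edge Left a) == Green)].

Definition is_reslucas (n : nat) (c : {ffun gedge n -> color}) : bool :=
  [&& [forall i, forall j, lucas_at c i j],
      all (side_alternating c) [:: Left; Top; Right; Bottom],
      corners_agree c
    & top_left_green c].

Definition ResLuc (n : nat) : Type :=
  {c : {ffun gedge n -> color} | is_reslucas c}.

(* Main.v *)
Require Import Defs.
From mathcomp Require Import all_boot all_order all_algebra.
From mathcomp Require Import zify.

Set Implicit Arguments.
Unset Strict Implicit.
Unset Printing Implicit Defensive.

Import Order.TTheory GRing.Theory Num.Theory.
Local Open Scope ring_scope.

(** An alternating sign matrix is determined by the partial sums of its rows and
    columns.  These lie in {0, 1}, start at 0 and end at 1, and the increments of
    the row and column sums agree at every entry: this is the six-vertex model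
    with domain wall boundary.  Label the edges of the grid by the partial sums
    and flip the label of the [k]-th edge of the [i]-th line whenever [i + k] is
    odd.  At each internal vertex this exchanges the six-vertex rule with the
    Lucas rule, and it turns the constant labels of each side into alternating
    ones that agree at the corners. *)

Definition int_of_bool (b : bool) : int := (b : nat)%:Z.

(** * Lines of an alternating sign matrix *)

(** The running sum is an accumulator, so inductions on the list can vary the starting value. *)
Fixpoint sums01 (b : int) (s : seq int) : bool :=
  (b \in [:: 0; 1]) && (if s is x :: s' then sums01 (b + x) s' else true).

Lemma sums01_hd b s : sums01 b s -> b \in [:: 0; 1].
Proof. by case: s => [|x s] /= /andP[]. Qed.

Lemma sums01_total b s : sums01 b s -> b + \sum_(x <- s) x \in [:: 0; 1].
Proof.
elim: s b => [|x s IHs] b /= /andP[b01 ss]; first by rewrite big_nil addr0.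
by rewrite big_cons addrA IHs.
Qed.

Lemma sums01_range b s : sums01 b s -> all (mem [:: -1; 0; 1 : int]) s.
Proof.
elim: s b => //= x s IHs b /andP[b01 ss]; rewrite (IHs _ ss) andbT.
move/sums01_hd: ss; move: b01; rewrite !inE.
by case/orP => /eqP-> /orP[] /eqP h; apply/or3P;
  [apply: Or32 | apply: Or33 | apply: Or31 | apply: Or32]; apply/eqP; lia.
Qed.

(* The partial sum is 1 exactly when the last nonzero entry was 1; a virtual
   entry -1 in front accounts for the initial sum 0. *)
Lemma path_sums01 (b : bool) s :
  all (mem [:: -1; 0; 1 : int]) s ->
  path (fun x y => x * y < 0) (if b then 1 else -1) [seq x <- s | x != 0]
    = sums01 (int_of_bool b) s.
Proof.
elim: s b => [|x s IHs] b /=; first by case: b.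
have -> : int_of_bool b \in [:: 0; 1] by case: b.
case/andP; rewrite !inE => x01 /IHs {}IHs.
(* An entry with the same sign as the last nonzero one pushes the sum to -1 or 2, where the test
   fails at once. *)
have nsums z : z \notin [:: 0; 1] -> sums01 z s = false.
  by move=> nz; apply/negP => /sums01_hd; apply/negP.
case/or3P: x01 => /eqP-> /=.
- by case: b; rewrite /= ?(IHs false) // nsums.
- by rewrite addr0 IHs.
- by case: b; rewrite /= ?(IHs true) // nsums.
Qed.

(** Alternation alone leaves the first sign free; total 1 forces it to be +1, so the virtual -1 in
    front does no harm. *)
Lemma alternating_sums01 s : \sum_(x <- s) x = 1 ->
  all (mem [:: -1; 0; 1 : int]) s && sign_alternating s = sums01 0 s.
Proof.
move=> s1; apply/andP/idP => [[rg]|ss]; last first.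
  have rg := sums01_range ss; split=> //.
  move: ss; rewrite -(path_sums01 false rg) /sign_alternating.
  exact: path_sorted.
rewrite -(path_sums01 false rg) /sign_alternating.
elim: s rg s1 => //= x s IHs /andP[]; rewrite !inE big_cons => x01 rg.
case/or3P: x01 => /eqP-> //=; last by rewrite add0r; apply: IHs.
(* A leading -1 is followed by entries whose sum is 0 or 1, so the total would be at most 0. *)
move=> s1; rewrite (path_sums01 false rg) => /sums01_total.
by rewrite add0r !inE => /orP[] /eqP e; rewrite e in s1.
Qed.

(** * Partial sums of a row or column *)

Definition psum n (F : 'I_n -> int) (k : nat) : int := \sum_(j < n | (j < k)%N) F j.

Lemma psum0 n (F : 'I_n -> int) : psum F 0 = 0.
Proof. by rewrite /psum big_pred0. Qed.

Lemma psum_all n (F : 'I_n -> int) : psum F n = \sum_j F j.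
Proof. by apply: eq_bigl => j; rewrite ltn_ord. Qed.

Lemma psumS n (F : 'I_n -> int) (j : 'I_n) : psum F j.+1 = psum F j + F j.
Proof.
rewrite /psum (bigD1 j) //= addrC; congr (_ + _).
by apply: eq_bigl => i; rewrite ltnS [RHS]ltn_neqAle andbC.
Qed.

Lemma psum_telescope n (F : 'I_n -> int) (u : nat -> int) :
  u 0%N = 0 -> (forall j, F j = u j.+1 - u j) ->
  forall k, (k <= n)%N -> psum F k = u k.
Proof.
move=> u0 Fu; elim=> [|k IHk] kn; first by rewrite psum0 u0.
by rewrite (psumS F (Ordinal kn)) Fu /= IHk ?(ltnW kn) // addrC subrK.
Qed.

Lemma sums01_psum n (F : 'I_n -> int) :
  sums01 0 [seq F j | j <- enum 'I_n] <->
  forall k, (k <= n)%N -> psum F k \in [:: 0; 1].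
Proof.
(* Peeling off the first entry moves the start from [b] to [b + F ord0], hence the generalization
   over [b]. *)
suff H b : sums01 b [seq F j | j <- enum 'I_n] <->
    forall k, (k <= n)%N -> b + psum F k \in [:: 0; 1].
  by rewrite H; split=> h k /h; rewrite add0r.
elim: n F b => [|n IHn] F b.
  rewrite (size0nil (size_enum_ord 0)) /= andbT; split=> [b01 k|/(_ 0%N isT)].
    by rewrite leqn0 => /eqP->; rewrite psum0 addr0.
  by rewrite psum0 addr0.
rewrite enum_ordSl /= -map_comp.
have pS k : psum F k.+1 = F ord0 + psum (F \o lift ord0) k.
  by rewrite /psum big_mkcond big_ord_recl /= [in RHS]big_mkcond.
split=> [/andP[b01 /IHn h] [|k] kn|h]; first by rewrite psum0 addr0.
  by rewrite pS addrA h.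
have := h 0%N isT; rewrite psum0 addr0 => -> /=; apply/IHn => k kn.
by rewrite -addrA -pS h.
Qed.

(** Bounded partial sums encode both the range of the entries and their sign alternation. *)
Definition unit_line n (F : 'I_n -> int) : Prop :=
  (forall k, (k <= n)%N -> psum F k \in [:: 0; 1]) /\ \sum_j F j = 1.

Lemma unit_lineP n (F : 'I_n -> int) :
  unit_line F <->
  [/\ forall j, F j \in [:: -1; 0; 1], \sum_j F j = 1
    & sign_alternating [seq F j | j <- enum 'I_n]].
Proof.
have sE : \sum_(x <- [seq F j | j <- enum 'I_n]) x = \sum_j F j.
  by rewrite big_map big_enum.
have rgE : all (mem [:: -1; 0; 1 : int]) [seq F j | j <- enum 'I_n] <->
    forall j, F j \in [:: -1; 0; 1].
  split=> [/allP h j|h]; first by apply: h; rewrite map_f ?mem_enum.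
  by apply/allP => _ /mapP[j _ ->]; apply: h.
split=> [[h01 s1]|[rg s1 alt]]; split=> //.
- by apply/rgE/sums01_range/sums01_psum.
- by move/sums01_psum: h01; rewrite -alternating_sums01 ?sE // => /andP[].
- by apply/sums01_psum; rewrite -alternating_sums01 ?sE // alt andbT; apply/rgE.
Qed.

Lemma is_asmP n (A : 'M[int]_n) :
  is_asm A <->
  (forall i, unit_line (A i)) /\ (forall j, unit_line (fun i => A i j)).
Proof.
split.
  case/and5P => /forallP rg /forallP rs /forallP cs /forallP ra /forallP ca.
  by split=> i; apply/unit_lineP; split=> //; try (by move=> j; have /forallP := rg j);
    try (by have /forallP := rg i); apply/eqP.
case=> hr hc; apply/and5P; split; apply/forallP => i;
  try (by have /unit_lineP[h /eqP s a] := hr i; try apply/forallP);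
  by have /unit_lineP[h /eqP s a] := hc i.
Qed.

(** By telescoping, any bit sequence from 0 to 1 is the sequence of partial sums of its own
    increments. *)
Lemma unit_line_bits n (F : 'I_n -> int) (u : nat -> bool) :
  u 0%N = false -> u n = true ->
  (forall j : 'I_n, F j = int_of_bool (u j.+1) - int_of_bool (u j)) ->
  unit_line F /\ forall k, (k <= n)%N -> (psum F k == 1) = u k.
Proof.
move=> u0 un Fu.
have pE k : (k <= n)%N -> psum F k = int_of_bool (u k).
  by move=> kn; apply: (psum_telescope (u := int_of_bool \o u)) => //=; rewrite u0.
split=> [|k /pE->]; last by case: (u k).
by split=> [k /pE->|]; [case: (u k) | rewrite -psum_all pE ?un].
Qed.

Lemma unit_line_diff n (F : 'I_n -> int) (j : 'I_n) : unit_line F ->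
  int_of_bool (psum F j.+1 == 1) - int_of_bool (psum F j == 1) = F j.
Proof.
case=> h _; have := h j.+1 (ltn_ord j); have := h j (ltnW (ltn_ord j)).
rewrite psumS !inE => /orP[] /eqP -> /orP[] /eqP e; rewrite e /int_of_bool /=;
  lia.
Qed.

(** * Edge labels of a coloring *)

(** The six-vertex label: the color with the parity flip undone. It is meaningful for [k <= n] only,
    since [inord] sends larger indices to 0. *)
Definition hbit n (c : {ffun gedge n -> color}) (i : 'I_n) (k : nat) : bool :=
  is_red (c (hedge i (inord k))) (+) odd (i + k).

Definition vbit n (c : {ffun gedge n -> color}) (j : 'I_n) (k : nat) : bool :=
  is_red (c (vedge j (inord k))) (+) odd (j + k).

Definition coloring n (h v : 'I_n -> nat -> bool) : {ffun gedge n -> color} :=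
  [ffun e : gedge n => match e with
    | inl (i, k) => if h i k (+) odd (i + k) then Red else Green
    | inr (j, k) => if v j k (+) odd (j + k) then Red else Green
    end].

Lemma hbit_coloring n (h v : 'I_n -> nat -> bool) i k :
  (k <= n)%N -> hbit (coloring h v) i k = h i k.
Proof.
move=> kn; rewrite /hbit ffunE /= inordK //.
by case: (h i k); case: (odd _).
Qed.

Lemma vbit_coloring n (h v : 'I_n -> nat -> bool) j k :
  (k <= n)%N -> vbit (coloring h v) j k = v j k.
Proof.
move=> kn; rewrite /vbit ffunE /= inordK //.
by case: (v j k); case: (odd _).
Qed.

Lemma coloring_bits n (c : {ffun gedge n -> color}) (h v : 'I_n -> nat -> bool) :
  (forall i k, (k <= n)%N -> h i k = hbit c i k) ->
  (forall j k, (k <= n)%N -> v j k = vbit c j k) ->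
  coloring h v = c.
Proof.
move=> hE vE; apply/ffunP => e; rewrite ffunE.
by case: e => [] [i k]; rewrite ?hE ?vE -1?ltnS // /hbit /vbit inord_val
  -addbA addbb addbF is_redK.
Qed.

Lemma eq_color (x y : color) : (x == y) = (is_red x == is_red y).
Proof. by case: x; case: y. Qed.

(** Unfolds the choice of rotation in [lucas_at], so that the local rule can be decided by
    computation. *)
Lemma exists_ord4 (P : pred nat) :
  [exists r : 'I_4, P r] = [|| P 0%N, P 1%N, P 2 | P 3].
Proof.
apply/existsP/or4P => [[[[|[|[|[|//]]]] ri] /= Pr]|].
- exact: Or41.
- exact: Or42.
- exact: Or43.
- exact: Or44.
by case=> Pr; [exists (@Ordinal 4 0 isT) | exists (@Ordinal 4 1 isT)
  | exists (@Ordinal 4 2 isT) | exists (@Ordinal 4 3 isT)].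
Qed.

(** The left and top edges have parity [i + j], the right and bottom edges the opposite one, so
    exactly one of these two pairs is flipped. This matches the six Lucas colorings with the six bit
    solutions of the equation; the monochromatic vertices are those with increment 1 or -1. *)
Lemma lucas_atP n (c : {ffun gedge n -> color}) (i j : 'I_n) :
  lucas_at c i j <->
  int_of_bool (hbit c i j.+1) - int_of_bool (hbit c i j) =
  int_of_bool (vbit c j i.+1) - int_of_bool (vbit c j i).
Proof.
rewrite /lucas_at (exists_ord4 (fun r => rot r _ == _)) /hbit /vbit /edges_around /=.
(* All four parities become [odd (i + j)] or its negation, leaving a finite check. *)
rewrite !addnS (addnC j i) /=.
by case: (c (hedge i (inord j))); case: (c (hedge i (inord j.+1)));
  case: (c (vedge j (inord i))); case: (c (vedge j (inord i.+1)));
  case: (odd (i + j)).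
Qed.

(** * Boundary conditions *)

Lemma inord0 n : inord 0 = ord0 :> 'I_n.+1.
Proof. by apply: val_inj; rewrite /= inordK. Qed.

Lemma inord_max n : inord n = ord_max :> 'I_n.+1.
Proof. by apply: val_inj; rewrite /= inordK. Qed.

Lemma side_alternatingP n (c : {ffun gedge n.+1 -> color}) (s : side) :
  side_alternating c s <->
  forall k, is_red (c (boundary_edge s k)) =
            is_red (c (boundary_edge s ord0)) (+) odd k.
Proof.
split=> [/forallP alt [k kn]|alt].
  elim: k kn => [|k IHk] kn.
    by rewrite addbF; congr (is_red (c (boundary_edge s _))); apply: val_inj.
  have /forallP/(_ (Ordinal kn))/implyP/(_ (eqxx _)) := alt (Ordinal (ltnW kn)).
  by rewrite eq_color IHk /= addbN; case: (_ (+) _); case: is_red.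
apply/forallP => k; apply/forallP => l; apply/implyP => /eqP lk.
by rewrite eq_color (alt k) (alt l) lk /= addbN; case: (_ (+) _).
Qed.

(** The parity flip turns alternating sides into constant ones; the corners and the normalization
    then fix the constants, giving the domain wall boundary. *)
Lemma boundaryP n (c : {ffun gedge n.+1 -> color}) :
  [&& all (side_alternating c) [:: Left; Top; Right; Bottom],
      corners_agree c & top_left_green c] <->
  (forall i, hbit c i 0 = false /\ hbit c i n.+1 = true) /\
  (forall j, vbit c j 0 = false /\ vbit c j n.+1 = true).
Proof.
have hL i : is_red (c (boundary_edge Left i)) = hbit c i 0 (+) odd i.
  by rewrite /hbit inord0 addn0 -addbA addbb addbF.
have hT i : is_red (c (boundary_edge Top i)) = vbit c i 0 (+) odd i.
  by rewrite /vbit inord0 addn0 -addbA addbb addbF.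
have hR i : is_red (c (boundary_edge Right i)) = hbit c i n.+1 (+) odd (i + n.+1).
  by rewrite /hbit inord_max -addbA addbb addbF.
have hB i : is_red (c (boundary_edge Bottom i)) = vbit c i n.+1 (+) odd (i + n.+1).
  by rewrite /vbit inord_max -addbA addbb addbF.
split.
  case/and3P => /and5P[/side_alternatingP aL /side_alternatingP aT
    /side_alternatingP aR /side_alternatingP aB _].
  move=> /forallP/(_ ord0)/forallP/(_ ord_max); rewrite !eqxx /= => /and4P[].
  rewrite !eq_color => /eqP cTL /eqP cTR /eqP cBR /eqP cBL.
  move=> /forallP/(_ ord0); rewrite eqxx /= eq_color => /eqP gr.
  (* The colors spread from the green edge: down the left side, around the top-left corner to the
     top, then around the top-right and bottom-left corners to the right and bottom. The term
     [odd n] is the parity of the last index. *)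
  have rL k : is_red (c (boundary_edge Left k)) = odd k by rewrite aL /= gr.
  have rT k : is_red (c (boundary_edge Top k)) = odd k by rewrite aT /= -cTL gr.
  have rR k : is_red (c (boundary_edge Right k)) = odd n (+) odd k.
    by rewrite aR /= -cTR rT.
  have rB k : is_red (c (boundary_edge Bottom k)) = odd n (+) odd k.
    by rewrite aB /= cBL rL.
  split=> i; split.
  - by move: (hL i); rewrite rL; case: hbit; case: odd.
  - by move: (hR i); rewrite rR oddD /=; case: hbit; case: odd; case: odd.
  - by move: (hT i); rewrite rT; case: vbit; case: odd.
  - by move: (hB i); rewrite rB oddD /=; case: vbit; case: odd; case: odd.
case=> hh vv.
have {}hL i : is_red (c (boundary_edge Left i)) = odd i by rewrite hL (hh i).1.
have {}hT i : is_red (c (boundary_edge Top i)) = odd i by rewrite hT (vv i).1.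
have {}hR i : is_red (c (boundary_edge Right i)) = odd (i + n).
  by rewrite hR (hh i).2 addnS /= negbK.
have {}hB i : is_red (c (boundary_edge Bottom i)) = odd (i + n).
  by rewrite hB (vv i).2 addnS /= negbK.
apply/and3P; split.
- by apply/and5P; split=> //; apply/side_alternatingP => k;
    rewrite ?hL ?hT ?hR ?hB ?oddD //= addbC.
- apply/forallP => a; apply/forallP => z; apply/implyP => /andP[/eqP a0].
  rewrite eqSS => /eqP zn.
  by rewrite !eq_color !(hL, hT, hR, hB) a0 zn !eqxx.
- by apply/forallP => a; apply/implyP => /eqP a0; rewrite eq_color hL a0.
Qed.

Lemma is_reslucasP n (c : {ffun gedge n.+1 -> color}) :
  is_reslucas c <->
  [/\ forall i j : 'I_n.+1,
        int_of_bool (hbit c i j.+1) - int_of_bool (hbit c i j) =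
        int_of_bool (vbit c j i.+1) - int_of_bool (vbit c j i),
      forall i, hbit c i 0 = false /\ hbit c i n.+1 = true
    & forall j, vbit c j 0 = false /\ vbit c j n.+1 = true].
Proof.
split=> [/andP[/forallP luc /boundaryP[hh vv]]|[luc hh vv]].
  by split=> // i j; apply/lucas_atP; have /forallP := luc i.
apply/andP; split; last by apply/boundaryP.
by apply/forallP => i; apply/forallP => j; apply/lucas_atP.
Qed.

(** * The bijection *)

Definition asm_coloring n (A : 'M[int]_n) : {ffun gedge n -> color} :=
  coloring (fun i k => psum (A i) k == 1) (fun j k => psum (fun i => A i j) k == 1).

(** Only horizontal labels are read; for a restricted Lucas-coloring the vertical increments give
    the same entries. *)
Definition coloring_asm n (c : {ffun gedge n -> color}) : 'M[int]_n :=
  \matrix_(i, j) (int_of_bool (hbit c i j.+1) - int_of_bool (hbit c i j)).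

Lemma asm_coloringP n (A : 'M[int]_n.+1) : is_asm A -> is_reslucas (asm_coloring A).
Proof.
case/is_asmP => hr hc; apply/is_reslucasP; split=> [i j|i|j].
- rewrite !hbit_coloring ?vbit_coloring // ?(ltnW (ltn_ord _)) //.
  by rewrite unit_line_diff // (unit_line_diff (F := fun i => A i j)).
- by rewrite !hbit_coloring // psum0 psum_all (hr i).2.
- by rewrite !vbit_coloring // psum0 psum_all (hc j).2.
Qed.

(** The line conditions make the matrix an ASM, and the recovered labels show that its coloring is
    [c] again. *)
Lemma coloring_asm_lines n (c : {ffun gedge n.+1 -> color}) : is_reslucas c ->
  (forall i, unit_line (coloring_asm c i) /\
     forall k, (k <= n.+1)%N -> (psum (coloring_asm c i) k == 1) = hbit c i k) /\
  (forall j, unit_line (fun i => coloring_asm c i j) /\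
     forall k, (k <= n.+1)%N ->
       (psum (fun i => coloring_asm c i j) k == 1) = vbit c j k).
Proof.
case/is_reslucasP => luc hh vv; split=> i.
  by apply: unit_line_bits => [||j]; rewrite ?(hh i).1 ?(hh i).2 // mxE.
(* Here [luc] trades the horizontal increment defining the entry for the vertical one. *)
by apply: unit_line_bits => [||j]; rewrite ?(vv i).1 ?(vv i).2 // mxE luc.
Qed.

Lemma coloring_asmP n (c : {ffun gedge n.+1 -> color}) :
  is_reslucas c -> is_asm (coloring_asm c).
Proof.
by case/coloring_asm_lines => hr hc; apply/is_asmP; split=> i;
  [case: (hr i) | case: (hc i)].
Qed.

Lemma asm_coloringK n (A : 'M[int]_n) : is_asm A -> coloring_asm (asm_coloring A) = A.
Proof.
case/is_asmP => hr _; apply/matrixP => i j; rewrite mxE.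
by rewrite !hbit_coloring ?(ltnW (ltn_ord _)) // unit_line_diff.
Qed.

Lemma coloring_asmK n (c : {ffun gedge n.+1 -> color}) :
  is_reslucas c -> asm_coloring (coloring_asm c) = c.
Proof.
case/coloring_asm_lines => hr hc; apply: coloring_bits => i k kn.
  exact: (hr i).2.
exact: (hc i).2.
Qed.

Theorem theorem3 (n : nat) (hn : (1 <= n)%N) :
  exists f : ASM n -> ResLuc n, bijective f.
Proof.
case: n hn => // n _.
exists (fun A : ASM n.+1 =>
  exist (@is_reslucas n.+1) (asm_coloring (sval A)) (asm_coloringP (svalP A))).
exists (fun c : ResLuc n.+1 =>
  exist (@is_asm n.+1) (coloring_asm (sval c)) (coloring_asmP (svalP c)))
  => [[A hA]|[c hc]]; apply: val_inj => /=.
  exact: asm_coloringK.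
exact: coloring_asmK.
Qed.
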